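(* Let $p$ be an odd prime, $k$ a positive integer, $q$ a prime power and $n$ a positive integer. If $q$ is not a power of $p$, then $EGZ(p,\mathbb{F}_q^n,p-1)=\infty$. If $q=p^k$, then, as $n\to\infty$ (with $p,k$ fixed), $$ EGZ(p, \mathbb{F}_q^n, p-1) \leq \begin{cases} q^{n + o(n)} &\text{ for } p=3,5 \text{ and } k=1, \\ (2.756^k +1)^{n + o(n)} &\text{ for } p=3 \text{ and } k \geq 2, \\ \left(2^k \sqrt{q}+1 \right)^{n+o(n)} &\text{ for } p \neq 3 \text{ and } q \geq 7. \end{cases} $$
   Context: $\mathbb{F}_q^n$ is viewed as a commutative ring with coordinatewise operations. For elements $g_1,\dots,g_t$ of a commutative ring $R$, $e_m(g_1,\dots,g_t)=\sum_{1\leq i_1<\cdots<i_m\leq t}\prod_{j=1}^m g_{i_j}$. A sequence over $R$ is a finite list of elements of $R$ (repetitions allowed); a subsequence of length $t$ is obtained by choosing $t$ distinct positions. For a finite commutative ring $R$, $EGZ(t,R,m)$ is the smallest positive integer $\ell$ such that every sequence $S$ over $R$ of length $|S|\geq \ell$ contains a subsequence $S'$ of length $t$ with $e_m(S')=0$ in $R$; if no such $\ell$ exists, $EGZ(t,R,m)=\infty$. *)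

(* Defs.v *)
From HB Require Import structures.
From mathcomp Require Import all_boot all_order all_algebra.
From Stdlib Require Import ClassicalEpsilon.
Set Implicit Arguments. Unset Strict Implicit. Unset Printing Implicit Defensive.
Import GRing.Theory.
Local Open Scope ring_scope.

(* F_q^n is modelled as {ffun 'I_n -> F}, with coordinatewise ring
   operations (MathComp's pointwise ring structure on finite functions).
   MathComp only provides the (non-commutative) pzRing structure; we add
   the evident commutativity. *)
HB.instance Definition _ (aT : finType) (R : comPzRingType) :=
  GRing.PzRing_hasCommutativeMul.Build {ffun aT -> R} (@ffun_mulC aT R).

Definition esym (R : comPzRingType) (m : nat) (s : seq R) : R :=
  \sum_(I : {set 'I_(size s)} | #|I| == m) \prod_(i in I) s`_i.

Definition has_zero_esym_subseq (R : comPzRingType) (t m : nat) (s : seq R)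
  : Prop :=
  exists b : bitseq,
    [/\ size b = size s, count id b = t & esym m (mask b s) = 0].

Definition EGZ_good (t : nat) (R : comPzRingType) (m l : nat) : Prop :=
  forall s : seq R, (l <= size s)%N -> has_zero_esym_subseq t m s.

Definition decP (P : Prop) : bool :=
  if excluded_middle_informative P then true else false.

Lemma decPP (P : Prop) : reflect P (decP P).
Proof. by rewrite /decP; case: excluded_middle_informative => H; constructor. Qed.

Definition EGZ_pred (t : nat) (R : comPzRingType) (m : nat) : pred nat :=
  fun l => decP ((0 < l)%N /\ EGZ_good t R m l).

Lemma EGZ_pred_ex (t : nat) (R : comPzRingType) (m : nat) :
  (exists l, (0 < l)%N /\ EGZ_good t R m l) -> exists l, EGZ_pred t R m l.
Proof. by case=> l Hl; exists l; apply/decPP. Qed.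

(* EGZ(t,R,m): Some l with l the smallest positive integer having the
   property, or None (standing for infinity) if no such l exists. *)
Definition EGZ (t : nat) (R : comPzRingType) (m : nat) : option nat :=
  match excluded_middle_informative
          (exists l, (0 < l)%N /\ EGZ_good t R m l) with
  | left H => Some (ex_minn (EGZ_pred_ex H))
  | right _ => None
  end.

(* Main.v *)
Require Import Defs.
From mathcomp Require Import all_boot all_order all_algebra.
From mathcomp Require Import all_field zify.
From Stdlib Require Import ClassicalEpsilon.
Set Implicit Arguments. Unset Strict Implicit. Unset Printing Implicit Defensive.
Import GRing.Theory.

(* In a coordinate where no entry vanishes, [e_{p-1}] of [p] elements is their
   product times the sum of their inverses. So among distinct vectors with a
   common support [J] one looks, after inverting coordinates, for [p] distinct
   vectors of sum zero in [F_q^J = F_p^(k |J|)], and a bound [K b^|J|] for sets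
   without such vectors sums up over [J] to [K (b + 1)^n].

   Such a bound comes from the slice rank form of the multicolored sum-free
   theorem: if [x_(1,i_1) + ... + x_(p,i_p) = 0] holds exactly when all [i_a]
   agree, then the family has at most [p |low_exps|] members. For [p = 3] this
   is the cap set bound. For [p >= 5] we follow Sauermann: let [r < p] be the
   largest number of distinct values of a zero-sum [p]-tuple in the set, and
   take disjoint zero-sum tuples with [r] values that repeat entries at the same
   positions, among them [a1] and [a2]. A zero-sum tuple [(x_(i_a, a))_a] then
   keeps this pattern, so a sum [x_(i_a1, a1) + x_(i_b, b)] determines
   [(i_a1, i_b)], as otherwise this pair could be exchanged while [a2] is kept.
   Hence at most [p p^d] pairs of distinct indices occur in such a tuple; an
   independent set of indices in this sparse graph is multicolored sum-free, so
   it has at most [p 4^d] elements, and the family has [O((4 p)^(d / 2))]. *)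

Lemma leq_card_bigcup (I T : finType) (P : pred I) (A : I -> {set T}) :
  #|\bigcup_(i | P i) A i| <= \sum_(i | P i) #|A i|.
Proof.
elim/big_rec2: _ => [|i m B _ leBm]; first by rewrite cards0.
by rewrite (leq_trans (leq_card_setU _ _)) // leq_add2l.
Qed.

(** * The multicolored sum-free theorem *)

Section SliceRank.
Local Open Scope ring_scope.

Definition row_support (K : fieldType) (L : nat) (h : 'rV[K]_L) : {set 'I_L} :=
  [set j | h 0 j != 0].

(** A row basis of [U] has [\rank U] columns forming an invertible minor; [u] is the combination of
    its rows equal to 1 on each of these columns. *)
Lemma submx_large_support (K : fieldType) (L : nat) (U : 'M[K]_L) :
  exists2 h : 'rV[K]_L, (h <= U)%MS & (\rank U <= #|row_support h|)%N.
Proof.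
set B := row_base U.
have Bfull : row_full B^T by rewrite /row_full mxrank_tr eq_row_base.
pose f := fullrankfun Bfull.
pose u := (invmx (rowsub f B^T) *m (const_mx 1 : 'cV_(\rank U)))^T.
exists (u *m B); first by rewrite (submx_trans (submxMl _ _)) // eq_row_base.
rewrite -[X in (X <= _)%N]card_ord -(card_imset _ (@fullrankfun_inj _ _ _ _ Bfull)).
apply/subset_leq_card/subsetP => _ /imsetP [i _ ->]; rewrite inE.
have -> : (u *m B) 0 (f i) = ((rowsub f B^T) *m u^T) i 0.
  by rewrite !mxE; apply: eq_bigr => j _; rewrite !mxE mulrC.
by rewrite trmxK mulKVmx ?fullrowsub_unit // mxE oner_eq0.
Qed.

Lemma rank_diag_mx_ge (K : fieldType) (L : nat) (d : 'rV[K]_L) :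
  (#|row_support d| <= \rank (diag_mx d))%N.
Proof.
pose S := row_support d.
pose P := \matrix_(i < #|S|, j < L) ((j == enum_val i)%:R / d 0 j).
pose Q : 'M[K]_(L, #|S|) := \matrix_(j, i) (j == enum_val i)%:R.
have PQ : P *m diag_mx d *m Q = 1%:M.
  apply/matrixP => i k; rewrite mul_mx_diag !mxE (bigD1 (enum_val i)) //= !mxE.
  rewrite eqxx mul1r mulVf; last by have := enum_valP i; rewrite /S inE.
  rewrite mul1r (inj_eq enum_val_inj) big1 ?addr0 // => j /negPf ne.
  by rewrite !mxE ne !mul0r.
rewrite -/S -[X in (X <= _)%N](mxrank1 K) -PQ.
by rewrite (leq_trans (mxrankM_maxl _ _)) // mxrankM_maxr.
Qed.

(* The linear-algebra half of the slice rank bound for a diagonal tensor: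
   vectors of large support in all spaces but two reduce it to the rank of a
   diagonal matrix. *)
Lemma sum_prod_eq0_dim (K : fieldType) (L m s : nat) (U : 'I_m -> 'M[K]_L) :
  (1 < m)%N -> (forall a, (L <= s + \rank (U a))%N) ->
  (forall h : 'I_m -> 'rV[K]_L, (forall a, (h a <= U a)%MS) ->
     \sum_j \prod_a h a 0 j = 0) ->
  (L <= m * s)%N.
Proof.
case: m U => [|[|m]] // U _ rkU sum0.
have /fin_all_exists2 [h hU hS] := fun a => submx_large_support (U a).
pose H := \row_j \prod_(a < m) h (lift ord0 (lift ord0 a)) 0 j.
pose b1 := lift ord0 ord0 : 'I_m.+2.
(* With all other factors fixed in [H], the vanishing sum says that the row spaces of [U ord0] and
   [U b1] are orthogonal for the form [diag_mx H]. *)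
have UHU : U ord0 *m diag_mx H *m (U b1)^T = 0.
  apply/matrixP => i k; rewrite mul_mx_diag !mxE.
  pose h' (a : 'I_m.+2) :=
    if a == ord0 then row i (U ord0) else if a == b1 then row k (U b1) else h a.
  rewrite -[RHS](sum0 h') => [|a]; last first.
    rewrite /h'; case: eqP => [->|_]; first exact: row_sub.
    by case: eqP => [->|_]; first exact: row_sub.
  by apply: eq_bigr => j _; rewrite !big_ord_recl /h' /= !mxE -mulrA [X in _ * X]mulrC.
have suppH : (L <= m * s + #|row_support H|)%N.
  pose S := row_support H; rewrite -/S.
  rewrite -[X in (X <= _)%N]card_ord -(cardC (mem S)) addnC leq_add2r.
  have sub : [set j | j \notin S] \subset
      \bigcup_(a < m) ~: row_support (h (lift ord0 (lift ord0 a))).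
    apply/subsetP => j; rewrite !inE negbK mxE => /eqP/eqP.
    case/prodf_eq0 => a _ /eqP ha0.
    by apply/bigcupP; exists a => //; rewrite !inE ha0 eqxx.
  have -> : #|predC (mem S)| = #|[set j | j \notin S]|.
    by apply: eq_card => j; rewrite !inE.
  apply: (leq_trans (subset_leq_card sub)).
  apply: (leq_trans (leq_card_bigcup _ _)).
  apply: (@leq_trans (\sum_(a < m) s)); last by rewrite sum_nat_const card_ord.
  apply: leq_sum => a _; rewrite -(leq_add2r #|row_support (h (lift ord0 (lift ord0 a)))|).
  rewrite addnC cardsC card_ord (leq_trans (rkU (lift ord0 (lift ord0 a)))) //.
  by rewrite leq_add2l hS.
(* Sylvester's inequality gives [r0 + rH <= r01 + L], and orthogonality gives [r01 + r1 <= L]. *)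
have := mulmx0_rank_max UHU; rewrite mxrank_tr.
have := mxrank_mul_min (U ord0) (diag_mx H).
have := leq_trans suppH (leq_add (leqnn _) (rank_diag_mx_ge H)).
have := rkU ord0; have := rkU b1.
rewrite !mulSn; move: (\rank _) (\rank _) (\rank _) (\rank _) (m * s)%N => r1 r0 rH r01 ms.
lia.
Qed.
End SliceRank.

(** * The zero-sum indicator as a polynomial over ['F_p], and its slice rank *)

Section ZeroSumIndicator.
Local Open Scope ring_scope.
Variables (p : nat) (I : finType).
Hypothesis p_pr : prime p.
Notation K := 'F_p.
Notation V := {ffun I -> K}.

Definition monomial (e : {ffun I -> 'I_p}) (v : V) : K := \prod_c v c ^+ e c.

Definition low_exps : {set {ffun I -> 'I_p}} :=
  [set e : {ffun I -> 'I_p} | (p * (\sum_c e c) <= p.-1 * #|I|)%N].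

(* Expanding [1 - (\sum_a y a) ^+ p.-1] by distributivity gives the term 1,
   encoded [inl tt], and one term for each choice [inr g] of a summand in each
   of the [p.-1] factors. *)
Definition expansion : finType := (unit + {ffun 'I_p.-1 -> 'I_p})%type.

Definition expansion_coef (o : expansion) : K := if o is inl _ then 1 else -1.

Definition expansion_deg (o : expansion) (a : 'I_p) : nat :=
  if o is inr g then #|[set t | g t == a]| else 0.

Lemma expansion_deg_sum (o : expansion) : (\sum_a expansion_deg o a <= p.-1)%N.
Proof.
case: o => [u|g] /=; first by rewrite sum_nat_const muln0.
rewrite -[X in (_ <= X)%N]card_ord -sum1_card (partition_big g predT) //=.
by apply: leq_sum => a _; rewrite -sum1dep_card.
Qed.

Lemma expansion_deg_lt (o : expansion) (a : 'I_p) : (expansion_deg o a < p)%N.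
Proof.
rewrite -[X in (_ < X)%N](prednK (prime_gt0 p_pr)) ltnS.
by rewrite (leq_trans _ (expansion_deg_sum o)) // (bigD1 a) //= leq_addr.
Qed.

Lemma eq0_indicator (S : K) : (S == 0)%:R = 1 - S ^+ p.-1.
Proof.
case: eqVneq => [->|nz].
  by rewrite expr0n -subn1 subn_eq0 leqNgt prime_gt1 // subr0.
apply/eqP; rewrite eq_sym subr_eq0 eq_sym; apply/eqP/(mulfI nz).
by have := expf_card S; rewrite card_Fp // -exprS prednK ?prime_gt0 // mulr1.
Qed.

Lemma eq0_expansion (y : 'I_p -> K) :
  (\sum_a y a == 0)%:R =
  \sum_o expansion_coef o * \prod_a y a ^+ expansion_deg o a.
Proof.
rewrite eq0_indicator big_sumType /=; congr (_ + _).
  by rewrite (big_pred1 tt) => [|[]] //; rewrite mul1r big1.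
have -> : (\sum_a y a) ^+ p.-1 = \prod_(t < p.-1) \sum_a y a.
  by rewrite prodr_const card_ord.
rewrite bigA_distr_bigA /= -sumrN; apply: eq_bigr => g _.
rewrite mulN1r (partition_big g predT) //=; congr (- _); apply: eq_bigr => a _.
rewrite (eq_bigr (fun _ => y a)) => [|t /eqP -> //].
by rewrite prodr_const; congr (_ ^+ _); apply: eq_card => t; rewrite !inE.
Qed.

Definition expansion_exp (G : {ffun I -> expansion}) (a : 'I_p) : {ffun I -> 'I_p} :=
  [ffun c => Ordinal (expansion_deg_lt (G c) a)].

(** The indicator is the product of its coordinatewise versions; distributivity then picks one term
    [G c] of [eq0_expansion] in each coordinate [c]. *)
Lemma zero_sum_expansion (v : 'I_p -> V) :
  (\sum_a v a == 0)%:R =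
  \sum_(G : {ffun I -> expansion}) (\prod_c expansion_coef (G c)) *
     \prod_a monomial (expansion_exp G a) (v a).
Proof.
have -> : (\sum_a v a == 0)%:R = \prod_c (\sum_a v a c == 0)%:R :> K.
  case: eqP => [v0|nv0].
    rewrite big1 // => c _.
    by have /ffunP/(_ c) := v0; rewrite sum_ffunE ffunE => ->; rewrite eqxx.
  case: (boolP [forall c, \sum_a v a c == 0]) => [/forallP all0|].
    by case: nv0; apply/ffunP => c; rewrite sum_ffunE ffunE; apply/eqP.
  by rewrite negb_forall => /existsP [c /negPf nz]; rewrite (bigD1 c) //= nz mul0r.
under eq_bigr => c _ do rewrite eq0_expansion.
rewrite bigA_distr_bigA /=; apply: eq_bigr => G _.
rewrite big_split /=; congr (_ * _); rewrite exchange_big /=.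
by apply: eq_bigr => a _; apply: eq_bigr => c _; rewrite ffunE.
Qed.

(** Pigeonhole: the [p] degrees add up to at most [p.-1 * #|I|], so one of them is at most the
    average. *)
Lemma expansion_exp_low (G : {ffun I -> expansion}) :
  exists a, expansion_exp G a \in low_exps.
Proof.
apply/existsP; apply: contraT; rewrite negb_exists => /forallP high.
have lt_a a : (p.-1 * #|I| < p * \sum_c expansion_exp G a c)%N.
  by have := high a; rewrite inE -ltnNge.
have : (\sum_(a < p) (p.-1 * #|I|).+1 <= \sum_(a < p) p * \sum_c expansion_exp G a c)%N.
  by apply: leq_sum => a _; apply: lt_a.
rewrite sum_nat_const card_ord -big_distrr /= leq_pmul2l ?prime_gt0 //.
rewrite exchange_big /= ltnNge => /negP; case.
rewrite mulnC -sum_nat_const; apply: leq_sum => c _.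
by under eq_bigr => a _ do rewrite ffunE /=; apply: expansion_deg_sum.
Qed.

(** The indicator of zero sums is a diagonal tensor here, and each term of its expansion has a low
    monomial in some variable. Contracting it with vectors that annihilate all low monomials gives
    0, and these vectors form spaces of codimension at most [#|low_exps|]. *)
Lemma multicolored_sum_free (L : nat) (x : 'I_p -> 'I_L -> V) :
  (forall f : 'I_p -> 'I_L,
     (\sum_a x a (f a) = 0) <-> (forall a b, f a = f b)) ->
  (L <= p * #|low_exps|)%N.
Proof.
move=> sum_free.
pose W a := \matrix_(j < L, i < #|low_exps|) monomial (enum_val i) (x a j).
apply: (@sum_prod_eq0_dim K L p #|low_exps| (fun a => kermx (W a))).
- exact: prime_gt1.
- move=> a; rewrite mxrank_ker -leq_subLR.
  by rewrite leq_sub2l // rank_leq_col.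
move=> h hW.
pose a0 : 'I_p := Ordinal (prime_gt0 p_pr).
have -> : \sum_j \prod_a h a 0 j =
    \sum_(f : {ffun 'I_p -> 'I_L}) \prod_a h a 0 (f a) *
       (\sum_a x a (f a) == 0)%:R.
  rewrite [RHS](bigID (fun f : {ffun 'I_p -> 'I_L} => f == [ffun=> f a0])) /=.
  rewrite [X in _ = _ + X]big1 ?addr0 => [|f nconst]; last first.
    case: eqP => [/sum_free fconst|]; last by rewrite mulr0.
    by case/eqP: nconst; apply/ffunP => a; rewrite ffunE.
  rewrite (reindex (fun j : 'I_L => [ffun=> j] : {ffun 'I_p -> 'I_L})) /=.
    apply: eq_big => [j|j _].
      by apply/Logic.eq_sym/eqP/ffunP => a; rewrite !ffunE.
    have -> : \sum_a x a ([ffun=> j] a) = 0 by apply/sum_free => a b; rewrite !ffunE.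
    by rewrite eqxx mulr1; apply: eq_bigr => a _; rewrite ffunE.
  exists (fun f : {ffun 'I_p -> 'I_L} => f a0) => [j _|f]; first by rewrite ffunE.
  by rewrite inE => /eqP {2}->.
under eq_bigr => f _ do rewrite zero_sum_expansion big_distrr /=.
rewrite exchange_big /= big1 // => G _.
have [a lowa] := expansion_exp_low G.
under eq_bigr => f _ do rewrite mulrCA -big_split /=.
rewrite -big_distrr /= -(bigA_distr_bigA (fun a j => h a 0 j * monomial (expansion_exp G a) (x a j))).
rewrite (bigD1 a) //= (_ : \sum_j _ = 0) ?mul0r ?mulr0 //.
have /sub_kermxP/rowP/(_ (enum_rank_in lowa (expansion_exp G a))) := hW a.
rewrite !mxE => sum0; rewrite -[RHS]sum0; apply: eq_bigr => j _.
by rewrite !mxE enum_rankK_in.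
Qed.
End ZeroSumIndicator.

Lemma leq_expn2r (m n e : nat) : m <= n -> m ^ e <= n ^ e.
Proof. by case: e => // e le_mn; rewrite leq_exp2r. Qed.

(** * Counting exponent vectors of low degree *)

Section CardLowExps.
Variables (p : nat) (I : finType).
Hypothesis p_gt0 : 0 < p.
Local Notation d := #|I|.

(* Chernoff's bound: weights [al <= be] penalize large exponents. The inequality is
   raised to the power [p] since low degree means degree at most
   [(p - 1) * d / p], which need not be an integer. *)
Lemma card_low_exps (al be : nat) : 0 < al -> al <= be ->
  #|low_exps p I| ^ p * (al ^ p.-1 * be ^ (p.-1 * p.-1)) ^ d
    <= ((\sum_(i < p) al ^ i * be ^ (p.-1 - i)) ^ p) ^ d.
Proof.
move=> al_gt0 le_al_be.
pose w (e : {ffun I -> 'I_p}) := \prod_c (al ^ e c * be ^ (p.-1 - e c)).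
have sum_w : \sum_e w e = (\sum_(i < p) al ^ i * be ^ (p.-1 - i)) ^ d.
  rewrite -(bigA_distr_bigA (fun (c : I) (i : 'I_p) => al ^ i * be ^ (p.-1 - i))) /=.
  by rewrite prod_nat_const.
have w_ge e : e \in low_exps p I ->
    (al ^ p.-1 * be ^ (p.-1 * p.-1)) ^ d <= w e ^ p.
  rewrite inE /w big_split /= -!expn_sum => low.
  set S := \sum_c e c in low *; set S' := \sum_c (p.-1 - e c).
  have SS' : S + S' = p.-1 * d.
    rewrite -big_split /= mulnC -sum_nat_const; apply: eq_bigr => c _.
    by rewrite subnKC // -ltnS prednK.
  rewrite !expnMn -!expnM [S * p]mulnC [S' * p]mulnC.
  have pSS' : p * S + p * S' = p.-1 * (p.-1 * d) + p.-1 * d.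
    by rewrite -mulnDr SS' -{1}(prednK p_gt0) mulSn addnC.
  have -> : p * S' = p.-1 * p.-1 * d + (p.-1 * d - p * S).
    rewrite -mulnA; move: pSS' low.
    by move: (p * S) (p * S') (p.-1 * (p.-1 * d)) (p.-1 * d); lia.
  rewrite expnD mulnA [X in _ <= X]mulnAC leq_mul2r; apply/orP; right.
  rewrite -[X in al ^ X](subnKC low) expnD leq_mul2l; apply/orP; right.
  exact: leq_expn2r.
rewrite expnAC -sum_w.
case: (set_0Vmem (low_exps p I)) => [->|[e0 low0]].
  by rewrite cards0 exp0n.
(* [#|low_exps|] times the least weight of a low vector is at most the total weight; only this least
   weight is raised to the power [p]. *)
case: (arg_minnP w low0) => e1 low1 min1.
apply: (@leq_trans ((#|low_exps p I| * w e1) ^ p)).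
  by rewrite [X in _ <= X]expnMn leq_mul2l w_ge ?orbT.
rewrite leq_exp2r // -sum_nat_const [X in _ <= X](bigID (mem (low_exps p I))) /=.
by apply: leq_trans (leq_addr _ _); apply: leq_sum => e /min1.
Qed.

(** Weights 1 and 2 give [#|low_exps p I| ^ p <= 2 ^ ((2 * p - 1) * d)], since
    [p * p - p.-1 * p.-1 = 2 * p - 1]. *)
Lemma card_low_exps_4 : #|low_exps p I| <= 4 ^ d.
Proof.
have geom : \sum_(i < p) 1 ^ i * 2 ^ (p.-1 - i) <= 2 ^ p.
  rewrite (reindex_inj rev_ord_inj) /= (eq_bigr (fun i : 'I_p => 2 ^ i)) => [|i _].
    by have := predn_exp 2 p; rewrite mul1n => <-; apply: leq_pred.
  by rewrite exp1n mul1n; congr (2 ^ _); case: i => i /= ?; lia.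
have := card_low_exps (isT : 0 < 1) (isT : 1 <= 2); rewrite exp1n mul1n => low.
have {low} : #|low_exps p I| ^ p * (2 ^ (p.-1 * p.-1)) ^ d <= ((2 ^ p) ^ p) ^ d.
  apply: leq_trans low _.
  by apply/leq_expn2r/leq_expn2r.
move=> low; rewrite -(leq_exp2r _ _ p_gt0).
rewrite -(@leq_pmul2r ((2 ^ (p.-1 * p.-1)) ^ d)) ?expn_gt0 //.
apply: leq_trans low _; rewrite -!expnM (_ : 4 = 2 ^ 2) // -expnM -expnD.
by rewrite leq_exp2l //; nia.
Qed.
End CardLowExps.

(** * Sets without [p] distinct elements of sum zero *)

Section IndependentSet.
Variables (T : finType) (E : rel T).

(** Double counting bounds the vertices of degree at least [D]. A maximal independent set among the
    others dominates them, and each of its members covers at most [D] vertices, itself included. The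
    factor 2 pays for symmetrizing [E]. *)
Lemma independent_set (D : nat) : 0 < D ->
  exists2 S : {set T}, (forall i j, i \in S -> j \in S -> i != j -> ~~ E i j) &
    #|T| * D <= #|S| * D * D + 2 * #|[set ij | E ij.1 ij.2]|.
Proof.
move=> D_gt0; pose e i j := E i j || E j i; pose N i := [set j | e i j].
pose Low := [set i | #|N i| < D].
pose indep (S : {set T}) :=
  (S \subset Low) && [forall i in S, forall j in S, (i != j) ==> ~~ e i j].
have indep0 : indep set0.
  by rewrite /indep sub0set; apply/forall_inP => i; rewrite inE.
have [S /maxsetP [/andP [SLow /forall_inP Sind] Smax] _] := maxset_exists indep0.
exists S => [i j iS jS ij|].
  have /forall_inP/(_ j jS)/implyP/(_ ij) := Sind i iS.
  by rewrite /e negb_or => /andP [].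
have LowS : #|Low| <= #|S| * D.
  rewrite -sum_nat_const; apply: (@leq_trans #|\bigcup_(i in S) (i |: N i)|).
    apply/subset_leq_card/subsetP => v vLow; case: (boolP (v \in S)) => vS.
      by apply/bigcupP; exists v => //; rewrite !inE eqxx.
    apply: contraT => far; case/negP: vS; rewrite -(Smax (v |: S)) ?subsetUr ?setU11 //.
    have nbr i : i \in S -> ~~ e i v /\ ~~ e v i.
      move=> iS; have : v \notin N i.
        apply: contra far => vN; apply/bigcupP; exists i => //.
        by rewrite inE vN orbT.
      by rewrite inE /e [E v i || _]orbC.
    rewrite /indep subUset sub1set vLow SLow /=.
    apply/forall_inP => i; rewrite !inE => /orP iS.
    apply/forall_inP => j; rewrite !inE => /orP jS; apply/implyP.
    case: iS => [/eqP ->|iS]; case: jS => [/eqP ->|jS]; first by rewrite eqxx.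
    - by move=> _; case: (nbr j jS).
    - by move=> _; case: (nbr i iS).
    by move=> ij; have /forall_inP/(_ j jS)/implyP/(_ ij) := Sind i iS.
  apply: (leq_trans (leq_card_bigcup _ _)); apply: leq_sum => i iS.
  have := subsetP SLow i iS; rewrite inE => degi.
  by rewrite (leq_trans (leq_card_setU _ _)) // cards1 add1n.
have high : #|~: Low| * D <= 2 * #|[set ij | E ij.1 ij.2]|.
  pose EE := [set ij : T * T | e ij.1 ij.2].
  have EE_le : #|EE| <= 2 * #|[set ij | E ij.1 ij.2]|.
    rewrite mul2n -addnn.
    have sub : EE \subset [set ij | E ij.1 ij.2] :|:
        (fun ij : T * T => (ij.2, ij.1)) @: [set ij | E ij.1 ij.2].
      apply/subsetP => -[i j]; rewrite !inE /e /= => /orP [->//|Eji].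
      by apply/orP; right; apply/imsetP; exists (j, i); rewrite ?inE.
    apply: leq_trans (subset_leq_card sub) _.
    by rewrite (leq_trans (leq_card_setU _ _)) // leq_add2l leq_imset_card.
  apply: leq_trans EE_le; rewrite -[X in _ <= X]sum1_card.
  rewrite [X in _ <= X](partition_big fst predT) //= -sum_nat_const.
  rewrite [X in _ <= X](bigID (mem (~: Low))) /=.
  apply: leq_trans (leq_addr _ _); apply: leq_sum => i.
  rewrite !inE -leqNgt => /leq_trans; apply.
  have /card_imset <- : injective (pair i : T -> T * T) by move=> j k [].
  rewrite sum1dep_card; apply/subset_leq_card/subsetP => _ /imsetP [j jN ->].
  by move: jN; rewrite !inE eqxx andbT.
by rewrite -(cardsC Low) mulnDl; apply: leq_add => //; rewrite leq_mul2r LowS orbT.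
Qed.
End IndependentSet.

(** * Disjoint zero-sum tuples with a common pattern of repetitions *)

Section ZeroSums.
Local Open Scope ring_scope.
Variables (p : nat) (I : finType).
Hypothesis p_pr : prime p.
Notation K := 'F_p.
Notation V := {ffun I -> K}.
Local Notation d := #|I|.

Let card_V : #|{: V}| = (p ^ d)%N.
Proof. by rewrite card_ffun card_Fp. Qed.

(* [pi] records which entries of the tuples [x i] coincide; [a1] and [a2] are
   two positions of a nontrivial block. *)
Section DisjointTuples.
Variables (L : nat) (x : 'I_L -> 'I_p -> V) (pi : 'I_p -> 'I_p) (a1 a2 : 'I_p).
Hypothesis x_sum0 : forall i, \sum_a x i a = 0.
Hypothesis x_inj : forall i j a, x i a = x j a -> i = j.
Hypothesis zero_sum_const : forall f : 'I_p -> 'I_L,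
  \sum_a x (f a) a = 0 -> forall a b, pi a = pi b -> f a = f b.
Hypotheses (a12 : a1 != a2) (pi_a12 : pi a1 = pi a2).

Let zero_sum_via (b : 'I_p) (ij : 'I_L * 'I_L) :=
  (ij.1 != ij.2) && [exists f : {ffun 'I_p -> 'I_L},
    [&& \sum_a x (f a) a == 0, f a1 == ij.1 & f b == ij.2]].

(* Two such pairs with the same sum could be exchanged in a zero-sum tuple,
   giving one that is not constant on the block of [a1] and [a2]. *)
Lemma card_zero_sum_via (b : 'I_p) : (#|[set ij | zero_sum_via b ij]| <= p ^ d)%N.
Proof.
rewrite -card_V; pose g (ij : 'I_L * 'I_L) := x ij.1 a1 + x ij.2 b.
rewrite -(card_in_imset (f := g)); first exact: max_card.
move=> [i j] [i' j']; rewrite !inE /g /zero_sum_via /= => /andP [ij /existsP [f]].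
case/and3P => /eqP f0 /eqP fa1 /eqP fb _ eq_sum.
case: (eqVneq i i') => [ii'|ii'].
  by move: eq_sum; rewrite ii' => /addrI/x_inj ->.
have ba1 : b != a1 by apply: contraNneq ij => ba1; rewrite -fa1 -fb ba1.
have fa2 : f a2 = i by rewrite -fa1; apply/Logic.eq_sym/zero_sum_const.
have ba2 : b != a2 by apply: contraNneq ij => ba2; rewrite -fa2 -fb ba2.
(* The exchange keeps the sum, but position [a2] still carries [i] while [a1] now carries [i']. *)
pose f' a := if a == a1 then i' else if a == b then j' else f a.
have f'0 : \sum_a x (f' a) a = 0.
  rewrite -[RHS]f0 (bigD1 a1) // (bigD1 b) //= [RHS](bigD1 a1) //= [in RHS](bigD1 b) //=.
  rewrite /f' eqxx (negPf ba1) eqxx fa1 fb !addrA eq_sum; congr (_ + _).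
  by apply: eq_bigr => a /andP [/negPf -> /negPf ->].
have := zero_sum_const f'0 pi_a12.
rewrite /f' eqxx [a2 == a1]eq_sym (negPf a12) [a2 == b]eq_sym (negPf ba2) fa2 => i'i.
by rewrite i'i eqxx in ii'.
Qed.

Lemma card_disjoint_tuples (D : nat) : (0 < D)%N ->
  (L * D <= p * #|low_exps p I| * D * D + 2 * (p * p ^ d))%N.
Proof.
move=> D_gt0.
have [S Sind] := independent_set (fun i j => [exists b, zero_sum_via b (i, j)]) D_gt0.
rewrite card_ord => /leq_trans; apply; apply: leq_add.
  apply/leq_mul => //; apply/leq_mul => //.
  apply: (@multicolored_sum_free p I p_pr _ (fun a i => x (enum_val i) a)) => f.
  split=> [f0 a b|fconst]; last first.
    rewrite -[RHS](x_sum0 (enum_val (f a1))).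
    by apply: eq_bigr => a _; rewrite (fconst a a1).
  (* If [f c] differed from [f a1], these two members of [S] would be joined by an edge via [c]. *)
  suff fa1 c : f c = f a1 by rewrite fa1 (fa1 b).
  apply: enum_val_inj; apply/eqP; rewrite eq_sym; apply: contraT => ne.
  have /negP := Sind _ _ (enum_valP (f a1)) (enum_valP (f c)) ne; case.
  apply/existsP; exists c; rewrite /zero_sum_via ne /=; apply/existsP.
  exists [ffun a => enum_val (f a)]; rewrite !ffunE !eqxx !andbT.
  by apply/eqP; rewrite -[RHS]f0; apply: eq_bigr => k _; rewrite ffunE.
rewrite leq_mul2l /= -[X in (X * _)%N]card_ord -sum_nat_const.
apply: (@leq_trans #|\bigcup_b [set ij | zero_sum_via b ij]|).
  apply/subset_leq_card/subsetP => -[i j]; rewrite inE => /existsP [b bij].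
  by apply/bigcupP; exists b; rewrite ?inE.
apply: leq_trans (leq_card_bigcup _ _) _.
by apply: leq_sum => b _; apply: card_zero_sum_via.
Qed.

Lemma card_disjoint_tuples_sqrt (N : nat) :
  (4 <= p)%N -> ((4 * p) ^ d <= N ^ 2)%N -> (L <= 4 * p * N)%N.
Proof.
move=> p_ge4 leN2.
have N_gt0 : (0 < N)%N.
  rewrite lt0n; apply: contraTneq leN2 => ->.
  by rewrite -ltnNge expn_gt0 muln_gt0 /= prime_gt0.
(* [N] plays the role of the square root of [(4 * p) ^ d]; a degree threshold near [p ^ d / N]
   balances the two terms of [card_disjoint_tuples]. *)
pose D := (p ^ d %/ N).+1.
have := card_disjoint_tuples (isT : (0 < D)%N); set low := #|low_exps p I|.
have low4 : (low <= 4 ^ d)%N := card_low_exps_4 I (prime_gt0 p_pr).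
have low4N : (4 ^ d <= N)%N.
  rewrite -leq_sqr (leq_trans _ leN2) // -mulnn -expnMn.
  by rewrite leq_expn2r // leq_mul2l.
have lowD : (low * D <= 2 * N)%N.
  rewrite /D mulnS mul2n -addnn leq_add //; first exact: leq_trans low4N.
  rewrite -(leq_pmul2r N_gt0) -mulnA mulnn (leq_trans _ leN2) // expnMn.
  by rewrite leq_mul // leq_divM.
have pD : (p ^ d <= N * D)%N by rewrite mulnC ltnW // ltn_ceil.
rewrite -[(p * low * D)%N]mulnA => LD; rewrite -(@leq_pmul2r D) //.
apply: (@leq_trans (p * (2 * N) * D + 2 * (p * (N * D)))); last by lia.
apply: leq_trans LD _; apply: leq_add; rewrite ?leq_mul2r ?leq_mul2l.
  by rewrite lowD !orbT.
by rewrite pD !orbT.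
Qed.
End DisjointTuples.
End ZeroSums.

(** * Bounds for zero-sum-free sets *)

Section ZeroSumFree.
Local Open Scope ring_scope.
Variables (p : nat) (I : finType).
Hypothesis p_pr : prime p.
Notation K := 'F_p.
Notation V := {ffun I -> K}.
Local Notation d := #|I|.
Implicit Types (A : {set V}) (y : {ffun 'I_p -> V}).

Lemma sum_const_Fp (v : V) : \sum_(a < p) v = 0.
Proof.
rewrite sumr_const card_ord; apply/ffunP => c; rewrite ffunMnE ffunE.
by rewrite -mulr_natr pchar_Fp_0 // mulr0.
Qed.

Definition zero_sum_tuple A y := (\sum_a y a == 0) && [forall a, y a \in A].

Definition values y : {set V} := [set y a | a : 'I_p].

(** A canonical representative of the block of positions sharing the value [y a], so that
    [first_pos y] records the repetitions of [y] but not its values. The default is never reached,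
    as [a] passes the test. *)
Definition first_pos y (a : 'I_p) : 'I_p := odflt a [pick b | y b == y a].

Lemma first_posK y a : y (first_pos y a) = y a.
Proof. by rewrite /first_pos; case: pickP => [b /eqP|]. Qed.

Lemma first_pos_eq y a b : y a = y b -> first_pos y a = first_pos y b.
Proof.
move=> ab; rewrite /first_pos (eq_pick (_ : _ =1 (fun c => y c == y b))).
  by case: pickP => [//|/(_ b)]; rewrite eqxx.
by move=> c /=; rewrite ab.
Qed.

Lemma card_first_pos y : #|values y| = #|[set first_pos y a | a : 'I_p]|.
Proof.
rewrite -(card_in_imset (f := y) (D := [set first_pos y a | a : 'I_p])).
  apply: eq_card => v; apply/imsetP/imsetP => -[a].
    by move=> _ ->; exists (first_pos y a); rewrite ?first_posK ?imset_f.
  by case/imsetP => b _ -> ->; exists b; rewrite ?first_posK.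
move=> _ _ /imsetP [a _ ->] /imsetP [b _ ->].
by rewrite !first_posK; apply: first_pos_eq.
Qed.

(* A zero-sum tuple assembled from the [x i] refines the common pattern of
   the [x i], so by maximality of [r] it has the same pattern. *)
Lemma zero_sum_first_pos_const A (r L : nat) (x : 'I_L -> {ffun 'I_p -> V})
    (pi : {ffun 'I_p -> 'I_p}) :
  (forall y, zero_sum_tuple A y -> (#|values y| <= r)%N) ->
  (forall i, #|values (x i)| = r) ->
  (forall i, finfun (first_pos (x i)) = pi) ->
  (forall i, zero_sum_tuple A (x i)) ->
  (forall i j a b, x i a = x j b -> i = j) ->
  forall f : 'I_p -> 'I_L,
    \sum_a x (f a) a = 0 -> forall a b, pi a = pi b -> f a = f b.
Proof.
move=> Ar xr xpi xA xdisj f f0 a b.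
have xpi' i c : pi c = first_pos (x i) c by rewrite -(xpi i) ffunE.
pose y : {ffun 'I_p -> V} := [ffun a => x (f a) a].
have yA : zero_sum_tuple A y.
  apply/andP; split.
    by apply/eqP; rewrite -[RHS]f0; apply: eq_bigr => c _; rewrite ffunE.
  by apply/forallP => c; rewrite ffunE; have /andP [_ /forallP] := xA (f c).
(* [P] embeds into the values of [y], so it has at most [r] elements, while its second projection
   has exactly [r]; hence that projection is injective. *)
pose P := [set (f c, pi c) | c : 'I_p].
have PP c : (f c, pi c) \in P by apply: imset_f.
have cardP : (#|P| <= r)%N.
  apply: leq_trans (Ar y yA); rewrite -(card_in_imset (f := fun ic => x ic.1 ic.2)).
    apply/subset_leq_card/subsetP => _ /imsetP [_ /imsetP [c _ ->] ->] /=.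
    by apply/imsetP; exists c; rewrite // ffunE (xpi' (f c)) first_posK.
  move=> _ _ /imsetP [c _ ->] /imsetP [c' _ ->] /= eq_x.
  have ff := xdisj _ _ _ _ eq_x; move: eq_x.
  rewrite ff !(xpi' (f c')) !first_posK => /first_pos_eq e.
  by congr (_, _).
have sndP : snd @: P = [set first_pos (x (f a)) c | c : 'I_p].
  apply/setP => v; apply/imsetP/imsetP => -[c].
    by case/imsetP => c' _ -> ->; exists c'; rewrite // -xpi'.
  by move=> _ ->; exists (f c, pi c); rewrite // -xpi'.
have /imset_injP inj : #|snd @: P| == #|P|.
  by rewrite eqn_leq leq_imset_card sndP -card_first_pos xr.
by move=> pi_ab; have [] := inj _ _ (PP a) (PP b) pi_ab.
Qed.

(** The family splits into at most [p ^ p] classes by pattern; since [r < p], each pattern has a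
    nontrivial block. *)
Lemma card_disjoint_zero_sums A (r N : nat) (F : {set {ffun 'I_p -> V}}) :
  (4 <= p)%N -> ((4 * p) ^ d <= N ^ 2)%N -> (r < p)%N ->
  (forall y, zero_sum_tuple A y -> (#|values y| <= r)%N) ->
  (forall y, y \in F -> zero_sum_tuple A y) ->
  (forall y, y \in F -> #|values y| = r) ->
  (forall y z a b, y \in F -> z \in F -> y a = z b -> y = z) ->
  (#|F| <= p ^ p * (4 * p * N))%N.
Proof.
move=> p_ge4 leN2 ltrp Ar FA Fr Fdisj.
rewrite -sum1_card (partition_big (fun y => finfun (first_pos y)) predT) //=.
have -> : (p ^ p)%N = #|{: {ffun 'I_p -> 'I_p}}| by rewrite card_ffun !card_ord.
rewrite -sum_nat_const; apply: leq_sum => pi _; rewrite sum1dep_card.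
set Fpi := [set y | _]; pose x (i : 'I_#|Fpi|) := enum_val i.
have xP i : (x i \in F) * (finfun (first_pos (x i)) = pi).
  by have := enum_valP i; rewrite inE => /andP [? /eqP].
case: (posnP #|Fpi|) => [->//|Fpi_gt0].
have xdisj i j a b : x i a = x j b -> i = j.
  by move=> e; apply: enum_val_inj; apply: Fdisj e; rewrite xP.
have i0 := Ordinal Fpi_gt0.
have /injectivePn [a1 [a2 a12 pi12]] : ~~ injectiveb pi.
  apply: contraL ltrp => /injectiveP pi_inj; rewrite -leqNgt -(Fr (x i0)) ?xP //.
  have /eq_imset e : first_pos (x i0) =1 pi by move=> a; rewrite -(xP i0) ffunE.
  by rewrite card_first_pos e card_imset // card_ord.
apply: (@card_disjoint_tuples_sqrt p I p_pr _ (fun i => x i) pi a1 a2) => //.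
- by move=> i; have /FA/andP [/eqP] := (xP i).1.
- by move=> i j a; apply: xdisj.
apply: (@zero_sum_first_pos_const A r) => // i; rewrite ?xP //.
- by apply: Fr; rewrite xP.
by apply: FA; rewrite xP.
Qed.

(* Removing a maximal disjoint family of zero-sum tuples with the largest
   possible number of distinct values lowers that number. *)
Lemma card_few_values A (r N : nat) :
  (4 <= p)%N -> ((4 * p) ^ d <= N ^ 2)%N -> (r < p)%N ->
  (forall y, zero_sum_tuple A y -> (#|values y| <= r)%N) ->
  (#|A| <= r * (p * (p ^ p * (4 * p * N))))%N.
Proof.
move=> p_ge4 leN2; elim: r A => [|r IHr] A ltrp Ar.
  rewrite leqn0 cards_eq0; apply/set0Pn => -[v vA].
  pose y : {ffun 'I_p -> V} := [ffun=> v].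
  have yA : zero_sum_tuple A y.
    apply/andP; split; last by apply/forallP => a; rewrite ffunE.
    by under eq_bigr => a _ do rewrite ffunE; rewrite sum_const_Fp.
  have := Ar y yA; rewrite leqn0 cards_eq0 => /eqP/setP/(_ (y (Ordinal (prime_gt0 p_pr)))).
  by rewrite imset_f // inE.
pose ok y := zero_sum_tuple A y && (#|values y| == r.+1).
pose indep (F : {set {ffun 'I_p -> V}}) := [forall y in F, ok y] &&
  [forall y in F, forall z in F, (y != z) ==> [disjoint values y & values z]].
have indep0 : indep set0.
  by rewrite /indep; apply/andP; split; apply/forall_inP => y; rewrite inE.
have [F /maxsetP [/andP [/forall_inP Fok /forall_inP Fdisj] Fmax] _] := maxset_exists indep0.
pose B := \bigcup_(y in F) values y.
have cardF : (#|F| <= p ^ p * (4 * p * N))%N.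
  apply: (@card_disjoint_zero_sums A r.+1) => //.
  - by move=> y /Fok /andP [].
  - by move=> y /Fok /andP [_ /eqP].
  move=> y z a b yF zF yz; apply/eqP; apply: contraT => ne.
  have /forall_inP/(_ z zF)/implyP/(_ ne) := Fdisj y yF.
  move/pred0P/(_ (y a)); rewrite /= {2}yz /values !imset_f //.
have cardB : (#|B| <= p * (p ^ p * (4 * p * N)))%N.
  apply: leq_trans (leq_card_bigcup _ _) _.
  apply: (@leq_trans (\sum_(y in F) p)); last by rewrite sum_nat_const mulnC leq_mul2l cardF orbT.
  by apply: leq_sum => y _; rewrite -[X in (_ <= X)%N]card_ord leq_imset_card.
have cardAB : (#|A :\: B| <= r * (p * (p ^ p * (4 * p * N))))%N.
  apply: IHr => [|y yAB]; first exact: ltnW.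
  have yA : zero_sum_tuple A y.
    case/andP: yAB => y0 /forallP yAB; apply/andP; split=> //.
    by apply/forallP => a; have := yAB a; rewrite inE => /andP [].
  have yB a : y a \notin B by have /andP [_ /forallP/(_ a)] := yAB; rewrite inE => /andP [].
  have := Ar y yA; rewrite leq_eqVlt => /orP [/eqP yr|//].
  have disj z : z \in F -> [disjoint values y & values z].
    move=> zF; rewrite disjoint_subset; apply/subsetP => _ /imsetP [a _ ->].
    by apply: contra (yB a) => yz; apply/bigcupP; exists z.
  (* By maximality, a tuple outside [B] with [r.+1] values would belong to [F], which puts its
     values into [B]. *)
  have yF : y \in F.
    rewrite -(Fmax (y |: F)) ?subsetUr ?setU11 //; apply/andP; split.
      apply/forall_inP => z; rewrite !inE => /orP [/eqP ->|/Fok //].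
      by rewrite /ok yA yr eqxx.
    apply/forall_inP => z; rewrite !inE => zF.
    apply/forall_inP => t; rewrite !inE => tF; apply/implyP.
    case/orP: zF => [/eqP ->|zF]; case/orP: tF => [/eqP ->|tF]; first by rewrite eqxx.
    - by move=> _; apply: disj.
    - by move=> _; rewrite disjoint_sym; apply: disj.
    by move=> zt; have /forall_inP/(_ t tF)/implyP/(_ zt) := Fdisj z zF.
  have /negP [] := yB (Ordinal (prime_gt0 p_pr)).
  by apply/bigcupP; exists y; rewrite ?imset_f.
rewrite -(cardsID B) mulSn leq_add //.
by rewrite (leq_trans _ cardB) // subset_leq_card // subsetIr.
Qed.

Lemma sum_values y : #|values y| = p -> \sum_a y a = \sum_(v in values y) v.
Proof.
move=> yp; rewrite big_imset //=.
by apply/imset_injP; rewrite -[#|_ @: _|]/(#|values y|) yp card_ord.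
Qed.

Definition zero_sum_free A :=
  forall B : {set V}, B \subset A -> #|B| = p -> \sum_(v in B) v != 0.

Lemma zero_sum_free_values A y :
  zero_sum_free A -> zero_sum_tuple A y -> (#|values y| <= p.-1)%N.
Proof.
move=> Afree /andP [/eqP y0 /forallP yA].
rewrite -ltnS prednK ?prime_gt0 // ltn_neqAle -[X in (_ <= X)%N]card_ord leq_imset_card andbT.
apply/eqP => yp; have := Afree (values y); rewrite -sum_values // y0 eqxx.
suff yAs : values y \subset A by move/(_ yAs yp).
by apply/subsetP => _ /imsetP [a _ ->].
Qed.

Lemma card_zero_sum_free A (N : nat) :
  (4 <= p)%N -> ((4 * p) ^ d <= N ^ 2)%N -> zero_sum_free A ->
  (#|A| <= p.-1 * (p * (p ^ p * (4 * p * N))))%N.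
Proof.
move=> p_ge4 leN2 Afree; apply: card_few_values => // [|y].
  by rewrite prednK ?prime_gt0.
exact: zero_sum_free_values.
Qed.

(** A zero-sum triple with a repeated value is constant in characteristic 3, so three copies of [A]
    are multicolored sum-free. *)
Lemma card_zero_sum_free_3 A :
  p = 3%N -> zero_sum_free A -> (#|A| <= 3 * #|low_exps p I|)%N.
Proof.
move=> p3 Afree; rewrite -{1}p3.
apply: (@multicolored_sum_free p I p_pr #|A| (fun _ i => enum_val i)) => f.
split=> [f0|fconst]; last first.
  pose a0 := Ordinal (prime_gt0 p_pr).
  by rewrite (eq_bigr (fun=> enum_val (f a0))) ?sum_const_Fp // => a _; rewrite (fconst a a0).
pose y : {ffun 'I_p -> V} := [ffun a => enum_val (f a)].
have yA : zero_sum_tuple A y.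
  apply/andP; split; last by apply/forallP => a; rewrite ffunE enum_valP.
  by apply/eqP; rewrite -[RHS]f0; apply: eq_bigr => a _; rewrite ffunE.
have yv := zero_sum_free_values Afree yA.
suff yconst a b : y a = y b.
  by move=> a b; have := yconst a b; rewrite !ffunE => /enum_val_inj.
have /injectivePn [a1 [a2 a12 y12]] : ~~ injectiveb y.
  apply: contraL yv => /injectiveP yinj.
  by rewrite /values card_imset // card_ord -ltnNge prednK ?prime_gt0.
suff y1 c : y c = y a1 by rewrite (y1 a) (y1 b).
case: (eqVneq c a1) => [->//|c1]; case: (eqVneq c a2) => [->//|c2].
have cover k : k \in [set c; a1; a2].
  suff -> : [set c; a1; a2] = setT by rewrite inE.
  apply/eqP; rewrite eqEcard subsetT cardsT card_ord -setUA !cardsU1 cards1 !inE.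
  by rewrite (negPf c1) (negPf c2) (negPf a12) p3.
apply/eqP; rewrite -subr_eq0; have /andP [/eqP y0 _] := yA.
have : \sum_a (y a - y a1) = 0 by rewrite sumrB y0 sum_const_Fp subrr.
rewrite (bigD1 c) //= big1 ?addr0 => [->//|k kc]; have := cover k.
rewrite !inE (negPf kc) /= => /orP [/eqP ->|/eqP ->]; last rewrite -y12; exact: subrr.
Qed.
End ZeroSumFree.

(** * Reduction of the EGZ constant to zero sums *)

Section ElementarySymmetric.
Local Open Scope ring_scope.
Variables (F : fieldType) (I : finType).
Implicit Types (s t : seq {ffun I -> F}).

Lemma esym_ffunE (m : nat) s (j : I) :
  Defs.esym m s j = \sum_(A : {set 'I_(size s)} | #|A| == m) \prod_(i in A) s`_i j.
Proof.
rewrite /Defs.esym sum_ffunE; apply: eq_bigr => A _.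
by rewrite (big_morph (fun f : {ffun I -> F} => f j) (id1 := 1) (op1 := *%R)) => [//|f g|];
  rewrite ffunE.
Qed.

Lemma card_predn_setC1 (n : nat) (A : {set 'I_n.+1}) :
  #|A| == n -> exists i, A = [set~ i].
Proof.
move=> /eqP cardA; have : #|~: A| == 1%N.
  by rewrite -(eqn_add2l n) -{1}cardA cardsC card_ord addn1.
by case/cards1P => i Ai; exists i; rewrite -Ai setCK.
Qed.

(* Where no entry vanishes, the symmetric function of degree one less than
   the length is the product of all entries times the sum of their inverses. *)
Lemma esym_predn_eq0 s :
  (1 < size s)%N ->
  (forall j, {in s &, forall g h : {ffun I -> F}, (g j == 0) = (h j == 0)}) ->
  (forall j, \sum_(g <- s) (g j)^-1 = 0) ->
  Defs.esym (size s).-1 s = 0.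
Proof.
move=> s_gt1 supp inv0; apply/ffunP => j; rewrite esym_ffunE ffunE.
have mem_s (i : 'I_(size s)) : s`_i \in s by rewrite mem_nth.
have {inv0} := inv0 j; rewrite (big_nth 0) big_mkord.
have {supp} := supp j.
move: (size s) (fun i => mem_s i) s_gt1 => [//|n] mem_n n_gt0 supp inv0 /=.
(* If one entry vanishes at [j] then all do, and each product has [n > 0] factors. *)
case: (eqVneq (s`_(ord0 : 'I_n.+1) j) 0) => [z0|nz0].
  rewrite big1 // => A /eqP cardA.
  have [i iA] : exists i, i \in A by apply/card_gt0P; rewrite cardA.
  by rewrite (bigD1 i) //= (eqP (_ : s`_i j == 0)) ?mul0r // (supp _ s`_(ord0 : 'I_n.+1)) ?z0.
have nz (i : 'I_n.+1) : s`_i j != 0 by rewrite (supp _ s`_(ord0 : 'I_n.+1)).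
transitivity (\sum_(A in [set [set~ i] | i : 'I_n.+1]) \prod_(i in A) s`_i j).
  apply: eq_bigl => A; apply/idP/imsetP => [/card_predn_setC1 [i ->]|[i _ ->]].
    by exists i.
  by rewrite cardsC1 card_ord.
rewrite big_imset /= => [|i i' _ _ /setC_inj/set1_inj //].
rewrite (eq_bigr (fun i : 'I_n.+1 => (\prod_(k < n.+1) s`_k j) * (s`_i j)^-1)) => [|i _].
  by rewrite -big_distrr /= inv0 mulr0.
rewrite [in RHS](bigD1 i) //= mulrAC mulfV // mul1r.
by apply: eq_bigl => k; rewrite !inE.
Qed.

Lemma has_zero_esym_subseqI (t m : nat) s s' :
  subseq s' s -> size s' = t -> Defs.esym m s' = 0 -> has_zero_esym_subseq t m s.
Proof.
by case/subseqP => b size_b -> tE ?; exists b; split; rewrite // -tE size_mask.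
Qed.
End ElementarySymmetric.

(** * From sequences to sets without vanishing inverse sums *)

Section EGZBound.
Local Open Scope ring_scope.
Variables (F : finFieldType) (I : finType) (p : nat).
Implicit Types (A B : {set {ffun I -> F}}).

Definition inv_sum_free A := forall B, B \subset A -> #|B| = p ->
  (forall j, {in B &, forall g h : {ffun I -> F}, (g j == 0) = (h j == 0)}) ->
  exists j, \sum_(g in B) (g j)^-1 != 0.

Lemma size_le_count (T : finType) (m : nat) (s : seq T) :
  (forall g, (count_mem g s <= m)%N) -> (size s <= m * #|[set g in s]|)%N.
Proof.
move=> cnt; rewrite -sum1_size (partition_big id predT) //=.
rewrite (bigID (fun g => g \in [set g in s])) /= [X in (_ + X)%N]big1 => [|g].
  rewrite addn0 mulnC -sum_nat_const; apply: leq_sum => g _.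
  rewrite sum1_count; exact: cnt.
by rewrite inE sum1_count => /count_memPn.
Qed.

(** In a sequence without the desired subsequence, no value occurs [p] times, because [p] equal
    inverses sum to 0, and the set of values is [inv_sum_free]. *)
Lemma EGZ_good_inv_sum_free (M : nat) :
  p%:R = 0 :> F -> (1 < p)%N ->
  (forall A, inv_sum_free A -> (#|A| <= M)%N) ->
  EGZ_good p {ffun I -> F} p.-1 (p.-1 * M).+1.
Proof.
move=> p0 p_gt1 AM s size_s.
case: (classic (has_zero_esym_subseq p p.-1 s)) => // noS; exfalso.
have sub_nz s' : subseq s' s -> size s' = p ->
    (forall j, {in s' &, forall g h : {ffun I -> F}, (g j == 0) = (h j == 0)}) ->
    exists j, \sum_(g <- s') (g j)^-1 != 0.
  move=> s's size_s' supp; apply/existsP; apply: contraT.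
  rewrite negb_exists => /forallP inv0; case: noS.
  apply: (has_zero_esym_subseqI s's size_s').
  rewrite -[in p.-1]size_s'; apply: esym_predn_eq0 => //; first by rewrite size_s'.
  by move=> j; apply/eqP; rewrite -[_ == _]negbK inv0.
have cnt g : (count_mem g s <= p.-1)%N.
  rewrite -ltnS prednK; last exact: ltnW.
  rewrite ltnNge; apply/negP => p_le.
  have sub : subseq (nseq p g) s.
    have -> : nseq p g = take p (filter (pred1 g) s).
      have /all_pred1P -> : all (pred1 g) (filter (pred1 g) s) by apply: filter_all.
      by rewrite take_nseq // size_filter.
    by apply: subseq_trans (take_subseq _ _) (filter_subseq _ _).
  have [|j] := sub_nz _ sub (size_nseq _ _).
    by move=> j h h'; rewrite !mem_nseq => /andP [_ /eqP ->] /andP [_ /eqP ->].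
  by rewrite big_nseq -Monoid.iteropE /= -/(_ *+ _) -mulr_natr p0 mulr0 eqxx.
have := size_le_count cnt.
rewrite leqNgt (leq_trans _ size_s) // ltnS leq_mul2l AM ?orbT // => B BA cardB supp.
pose s' := [seq g <- undup s | g \in B].
have s'B : s' =i B.
  move=> g; rewrite mem_filter mem_undup andbC; case: (boolP (g \in B)) => gB; last by rewrite andbF.
  by rewrite andbT; have := subsetP BA g gB; rewrite inE.
have s'u : uniq s' by rewrite filter_uniq ?undup_uniq.
have [|||j nz] := sub_nz s'.
- exact: subseq_trans (filter_subseq _ _) (undup_subseq _).
- by rewrite -cardB -(eq_card s'B) (card_uniqP s'u).
- by move=> j g h; rewrite !s'B; apply: supp.
exists j; move: nz; rewrite (big_uniq _ s'u) /=.
by rewrite (eq_bigl _ _ s'B).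
Qed.
End EGZBound.

(** * Splitting by support and passing to the prime field *)

Section Supports.
Import VectorInternalTheory.
Local Open Scope ring_scope.
Variables (p k : nat) (F : finFieldType).
Hypotheses (p_pr : prime p) (cardF : #|F| = (p ^ k)%N).

Lemma additive_coordinates :
  exists2 phi : F -> 'rV['F_p]_k, {morph phi : x y / x + y} & injective phi.
Proof.
have charF := card_finPcharP cardF p_pr.
pose E := pPrimeCharType charF.
have dimE : dim E = k by rewrite -dimvf pprimeChar_dimf [#|_|]cardF pfactorK.
rewrite -dimE; exists (fun x : F => v2r (x : E)) => x y.
  exact: (raddfD (@v2r _ E)).
exact: v2r_inj.
Qed.

Variable n : nat.
Implicit Types (A : {set {ffun 'I_n -> F}}) (J : {set 'I_n}).

Definition supp (g : {ffun 'I_n -> F}) : {set 'I_n} := [set j | g j != 0].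

(* Inverting the nonzero coordinates turns a set of vectors of support [J]
   into a subset of a vector space of dimension [k * #|J|] over ['F_p]. *)
Lemma inv_sum_free_support A J : inv_sum_free p A ->
  exists2 Z : {set {ffun {j | j \in J} * 'I_k -> 'F_p}}, zero_sum_free Z &
    #|Z| = #|[set g in A | supp g == J]|.
Proof.
move=> Afree; have [phi phiD phi_inj] := additive_coordinates.
set AJ := [set g in A | _].
have phi0 : phi 0 = 0 by apply: (addrI (phi 0)); rewrite -phiD !addr0.
pose Phi (g : {ffun 'I_n -> F}) : {ffun {j | j \in J} * 'I_k -> 'F_p} :=
  [ffun ji => phi (g (val ji.1))^-1 0 ji.2].
have suppAJ g j : g \in AJ -> (g j != 0) = (j \in J).
  by rewrite inE => /andP [_ /eqP <-]; rewrite inE.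
have Phi_inj : {in AJ &, injective Phi}.
  move=> g h gA hA /ffunP gh; apply/ffunP => j.
  case: (boolP (j \in J)) => jJ.
    apply/invr_inj/phi_inj/rowP => i; have := gh (Sub j jJ, i).
    by rewrite !ffunE /=.
  have := suppAJ _ j gA; have := suppAJ _ j hA.
  by rewrite (negPf jJ) => /eqP -> /eqP ->.
exists (Phi @: AJ); last exact: card_in_imset.
move=> B' B'sub cardB'; apply/eqP => sum0.
pose B := AJ :&: Phi @^-1: B'.
have B'E : B' = Phi @: B.
  apply/setP => v; apply/idP/imsetP => [vB|[g]].
    have /imsetP [g gA vE] := subsetP B'sub v vB.
    by exists g; rewrite // !inE -vE vB andbT; move: gA; rewrite inE.
  by rewrite !inE => /andP [_ gB] ->.
have BAJ g : g \in B -> g \in AJ by rewrite inE => /andP [].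
have PhiB_inj : {in B &, injective Phi}.
  by move=> g h /BAJ gA /BAJ; apply: Phi_inj.
have [|||j] := Afree B.
- by apply/subsetP => g /BAJ; rewrite inE => /andP [].
- by rewrite -cardB' B'E card_in_imset.
- by move=> j g h /BAJ gA /BAJ hA; apply: negb_inj; rewrite !suppAJ.
case: (boolP (j \in J)) => jJ; last first.
  rewrite big1 ?eqxx // => g /BAJ /(suppAJ g j).
  by rewrite (negPf jJ) => /eqP ->; rewrite invr0.
case/eqP; apply: phi_inj; rewrite phi0 (big_morph phi phiD phi0).
apply/rowP => i; move: sum0; rewrite B'E big_imset //= => /ffunP/(_ (Sub j jJ, i)).
rewrite sum_ffunE ffunE summxE mxE => sum0; rewrite -[RHS]sum0.
by apply: eq_bigr => g _; rewrite ffunE.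
Qed.
End Supports.

(** * Fields whose order is not a power of [p] *)

Section InfiniteEGZ.
Local Open Scope ring_scope.

Lemma esym_ones (F : fieldType) (I : finType) (m : nat) (s : seq {ffun I -> F}) (j : I) :
  {in s, forall g, g = 1} -> Defs.esym m s j = 'C(size s, m)%:R.
Proof.
move=> s1; rewrite esym_ffunE (eq_bigr (fun=> 1)) => [|A _].
  rewrite (eq_bigl (fun A : {set _} => A \in [set A : {set 'I_(size s)} | #|A| == m])).
    by rewrite sumr_const card_draws card_ord.
  by move=> A; rewrite inE.
by rewrite big1 // => i _; have /s1 -> : s`_i \in s; rewrite ?mem_nth // ffunE.
Qed.

(** On a constant sequence of ones the symmetric function is ['C(p, p.-1) = p], which vanishes only
    in characteristic [p]. *)
Lemma EGZ_None (p : nat) (F : finFieldType) (n : nat) :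
  prime p -> (~ exists k, #|F| = expn p k) -> (0 < n)%N ->
  EGZ p {ffun 'I_n -> F} p.-1 = None.
Proof.
move=> p_pr not_pow n_gt0; rewrite /EGZ.
case: excluded_middle_informative => // ex_l; exfalso; have [l [_ good]] := ex_l.
have [|b [size_b cnt]] := good (nseq l 1); first by rewrite size_nseq.
move/ffunP/(_ (Ordinal n_gt0)); rewrite esym_ones => [|g /mem_mask]; last first.
  by rewrite mem_nseq => /andP [_ /eqP].
rewrite size_mask // cnt ffunE -[in 'C(p, _)](prednK (prime_gt0 p_pr)) binSn.
rewrite prednK ?prime_gt0 // => p0; apply: not_pow.
have charF : p \in [pchar F] by rewrite inE p_pr p0 eqxx.
exists (logn p #|pPrimeCharType charF|).
exact: (card_pprimeChar charF).
Qed.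
End InfiniteEGZ.

(** * Real bounds *)

(* Loaded only here: these libraries rebind the scope keys [%R] and [%N]. *)
From Stdlib Require Import Reals Lra.

Section RealBounds.

Lemma INR_leq (m n : nat) : m <= n -> (INR m <= INR n)%R.
Proof. by move/leP/le_INR. Qed.

Lemma INR_muln (m n : nat) : INR (m * n) = (INR m * INR n)%R.
Proof. exact: mult_INR. Qed.

Lemma INR_addn (m n : nat) : INR (m + n) = (INR m + INR n)%R.
Proof. exact: plus_INR. Qed.

Lemma INR_expn (m n : nat) : INR (expn m n) = (INR m ^ n)%R.
Proof. by elim: n => //= n <-; rewrite expnS INR_muln. Qed.

(** Pascal's rule splits the sum into those for [f] with constant [K] and for the shift of [f] with
    constant [K * b]. *)
Lemma INR_binomial_sum (n : nat) (f : nat -> nat) (K b : R) :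
  (forall j, (INR (f j) <= K * b ^ j)%R) ->
  (INR (\sum_(j < n.+1) 'C(n, j) * f j) <= K * (b + 1) ^ n)%R.
Proof.
elim: n f K => [|n IHn] f K fK.
  by have := fK 0; rewrite big_ord_recl big_ord0 bin0 mul1n addn0 /=; lra.
have -> : \sum_(j < n.+2) 'C(n.+1, j) * f j =
    \sum_(j < n.+1) 'C(n, j) * f j + \sum_(j < n.+1) 'C(n, j) * f j.+1.
  transitivity (\sum_(j < n.+2) 'C(n, j) * f j + \sum_(j < n.+1) 'C(n, j) * f j.+1).
    rewrite !(big_ord_recl n.+1) /= !bin0 -addnA -big_split /=; congr (_ + _).
    by apply: eq_bigr => j _; rewrite binS mulnDl.
  by rewrite big_ord_recr /= bin_small // mul0n addn0.
have := IHn f K fK; have := IHn (fun j => f j.+1) (K * b)%R.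
rewrite INR_addn => H1 H2.
have {}H1 : (INR (\sum_(j < n.+1) 'C(n, j) * f j.+1) <= K * b * (b + 1) ^ n)%R.
  by apply: H1 => j; have := fK j.+1 => /=; lra.
apply: (Rle_trans _ _ _ (Rplus_le_compat _ _ _ _ H2 H1)); apply: Req_le => /=; ring.
Qed.

Lemma INR_sum_sets (n : nat) (a : {set 'I_n} -> nat) (K b : R) :
  (0 <= K)%R -> (0 <= b)%R -> (forall J, (INR (a J) <= K * b ^ #|J|)%R) ->
  (INR (\sum_J a J) <= K * (b + 1) ^ n)%R.
Proof.
move=> K_ge0 b_ge0 aK; pose f j := \max_(J : {set 'I_n} | #|J| == j) a J.
apply: (Rle_trans _ (INR (\sum_(j < n.+1) 'C(n, j) * f j))).
  apply: INR_leq; rewrite (partition_big (fun J : {set 'I_n} => inord #|J| : 'I_n.+1) predT) //=.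
  apply: leq_sum => j _.
  have cardE (J : {set 'I_n}) : (inord #|J| == j) = (#|J| == j).
    by rewrite -val_eqE /= inordK // ltnS -[X in _ <= X]card_ord max_card.
  rewrite (eq_bigl _ _ cardE).
  apply: (@leq_trans (\sum_(J : {set 'I_n} | #|J| == j) f j)).
    by apply: leq_sum => J Jj; apply: (leq_bigmax_cond (F := a)).
  by rewrite sum_nat_cond_const card_draws card_ord.
apply: INR_binomial_sum => j; rewrite /f; elim/big_ind: _ => /=.
- by apply: Rmult_le_pos => //; apply: pow_le.
- by move=> x y ? ?; case: (leqP x y).
by move=> J /eqP <-.
Qed.

(** The least [N] satisfies [N - 1 < s], and [1 <= s] absorbs the rounding. *)
Lemma exists_nat_sqrt (X : nat) (s : R) : (1 <= s)%R -> (INR X <= s ^ 2)%R ->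
  exists2 N : nat, X <= expn N 2 & (INR N <= 2 * s)%R.
Proof.
move=> s_ge1 Xs; have exN : exists N, X <= expn N 2.
  by exists X; case: X {Xs} => // X; rewrite -[X in X <= _]expn1 leq_pexp2l.
case: (ex_minnP exN) => N XN minN; exists N => //.
case: N XN minN => [|N] XN minN; first by rewrite /=; lra.
have NX : (INR N ^ 2 < s ^ 2)%R.
  apply: Rlt_le_trans Xs; rewrite -INR_expn; apply/lt_INR/ltP.
  by rewrite ltnNge; apply/negP => /minN; rewrite ltnn.
have := pos_INR N; rewrite S_INR; nra.
Qed.

(* The ratio 3/5 is close to the minimizer of [(1 + g + g ^ 2) ^ 3 / g ^ 2],
   and [49 ^ 3 / (3 ^ 2 * 5 ^ 4) < 2.756 ^ 3]. *)
Lemma card_zero_sum_free_3_INR (I : finType) (Z : {set {ffun I -> 'F_3}}) :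
  zero_sum_free Z -> (INR #|Z| <= 3 * 2.756 ^ #|I|)%R.
Proof.
move=> Zfree; have /INR_leq := @card_zero_sum_free_3 3 I isT Z erefl Zfree.
rewrite INR_muln; set w := INR #|low_exps 3 I| => Zw.
suff : (w <= 2.756 ^ #|I|)%R by move: Zw => /=; lra.
have low : (w ^ 3 * (3 ^ 2 * 5 ^ 4) ^ #|I| <= (49 ^ 3) ^ #|I|)%R.
  have := @card_low_exps 3 I isT 3 5 isT isT.
  rewrite (_ : \sum_(i < 3) _ = 49); last by rewrite !big_ord_recl big_ord0.
  by move/INR_leq; rewrite INR_muln !INR_expn INR_muln !INR_expn -/w !INR_IZR_INZ.
have w_ge0 : (0 <= w)%R := pos_INR _.
have t_gt0 : (0 < 2.756 ^ #|I|)%R by apply: pow_lt; lra.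
have B_gt0 : (0 < (3 ^ 2 * 5 ^ 4) ^ #|I|)%R by apply: pow_lt; lra.
have : ((49 ^ 3) ^ #|I| <= (2.756 ^ 3 * (3 ^ 2 * 5 ^ 4)) ^ #|I|)%R by apply: pow_incr; lra.
rewrite Rpow_mult_distr -(pow_mult 2.756) Nat.mul_comm pow_mult => up.
have w3 := Rmult_le_reg_r _ _ _ B_gt0 (Rle_trans _ _ _ low up).
apply: Rnot_lt_le => lt_tw; move: w3 => /=; apply: Rlt_not_le.
move: (2.756 ^ _)%R t_gt0 lt_tw => t t_gt0 lt_tw.
have tt_ww : (t * t < w * w)%R by apply: Rmult_le_0_lt_compat; lra.
have := Rmult_le_0_lt_compat t w (t * t) (w * w); nra.
Qed.

Lemma card_zero_sum_free_INR (p : nat) : prime p -> 4 <= p ->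
  exists2 K : R, (0 <= K)%R & forall (I : finType) (Z : {set {ffun I -> 'F_p}}),
    zero_sum_free Z -> (INR #|Z| <= K * (2 * sqrt (INR p)) ^ #|I|)%R.
Proof.
move=> p_pr p_ge4; exists (INR (p.-1 * (p * (expn p p * (4 * p)))) * 2)%R.
  by apply: Rmult_le_pos; [exact: pos_INR | lra].
move=> I Z Zfree; set s := ((2 * sqrt (INR p)) ^ #|I|)%R.
have p_ge1 : (1 <= INR p)%R by apply: (@INR_leq 1); rewrite prime_gt0.
have sqrt_ge1 : (1 <= sqrt (INR p))%R by rewrite -sqrt_1; apply: sqrt_le_1_alt.
have s_ge1 : (1 <= s)%R by apply: pow_R1_Rle; lra.
have s2 : (INR (expn (4 * p) #|I|) <= s ^ 2)%R.
  rewrite INR_expn INR_muln /s -pow_mult Nat.mul_comm pow_mult.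
  apply: Req_le; congr (_ ^ _)%R; have := sqrt_sqrt (INR p); rewrite /=; nra.
have [N XN Ns] := exists_nat_sqrt s_ge1 s2.
have := INR_leq (card_zero_sum_free p_pr p_ge4 XN Zfree).
rewrite (_ : _ * _ = p.-1 * (p * (expn p p * (4 * p))) * N); last by rewrite !mulnA.
rewrite INR_muln => Z_le; rewrite Rmult_assoc.
exact: (Rle_trans _ _ _ Z_le (Rmult_le_compat_l _ _ _ (pos_INR _) Ns)).
Qed.

Lemma card_inv_sum_free_INR (p k n : nat) (F : finFieldType) (K beta : R)
    (A : {set {ffun 'I_n -> F}}) :
  prime p -> #|F| = expn p k -> (0 <= K)%R -> (0 <= beta)%R ->
  (forall (I : finType) (Z : {set {ffun I -> 'F_p}}),
     zero_sum_free Z -> (INR #|Z| <= K * beta ^ #|I|)%R) ->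
  inv_sum_free p A -> (INR #|A| <= K * (beta ^ k + 1) ^ n)%R.
Proof.
move=> p_pr cardF K_ge0 beta_ge0 bound Afree.
have -> : #|A| = \sum_J #|[set g in A | supp g == J]|.
  rewrite -sum1_card (partition_big (@supp F n) predT) //=.
  by apply: eq_bigr => J _; rewrite sum1dep_card.
apply: INR_sum_sets => // [|J]; first exact: pow_le.
have [Z Zfree <-] := inv_sum_free_support p_pr cardF J Afree.
have := bound _ Z Zfree.
by rewrite card_prod card_sig card_ord mulnC -pow_mult.
Qed.

Lemma EGZ_le (R : comPzRingType) (t m l : nat) :
  0 < l -> EGZ_good t R m l -> exists2 l', EGZ t R m = Some l' & l' <= l.
Proof.
move=> l_gt0 good; rewrite /EGZ.
case: excluded_middle_informative => [H|[]]; last by exists l.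
eexists; first by [].
by case: ex_minnP => l' _; apply; apply/(Defs.decPP _).
Qed.

Lemma EGZ_asymptotic (p k : nat) (F : finFieldType) (K c : R) :
  prime p -> #|F| = expn p k -> (0 <= K)%R -> (1 < c)%R ->
  (forall n (A : {set {ffun 'I_n -> F}}),
     inv_sum_free p A -> (INR #|A| <= K * c ^ n)%R) ->
  forall eps : R, (0 < eps)%R ->
  exists N : nat, forall n : nat, N <= n ->
    exists l : nat, EGZ p {ffun 'I_n -> F} p.-1 = Some l /\
                    (INR l <= Rpower c (INR n * (1 + eps)))%R.
Proof.
move=> p_pr cardF K_ge0 c_gt1 bound eps eps_gt0.
pose K' := (INR p.-1 * K + 1)%R.
have K'_gt0 : (0 < K')%R.
  by have := Rmult_le_pos _ _ (pos_INR p.-1) K_ge0; rewrite /K'; lra.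
have lnc_gt0 : (0 < ln c)%R by rewrite -ln_1; apply: ln_increasing; lra.
(* From this [N] on, [c ^ (eps * n)] absorbs the constant factor [K']. *)
have [N largeN] := INR_archimed _ (ln K') (Rmult_lt_0_compat _ _ eps_gt0 lnc_gt0).
exists N => n Nn.
pose M := \max_(A : {set {ffun 'I_n -> F}} | Defs.decP (inv_sum_free p A)) #|A|.
have M_le : (INR M <= K * c ^ n)%R.
  rewrite /M; elim/big_ind: _ => /=.
  - by apply: Rmult_le_pos => //; apply: pow_le; lra.
  - by move=> x y ? ?; case: (leqP x y).
  by move=> A /(Defs.decPP _); apply: bound.
have [||l El l_le] := @EGZ_le {ffun 'I_n -> F} p p.-1 (p.-1 * M).+1 => //.
  have /andP [_ /eqP p0] := card_finPcharP cardF p_pr.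
  apply: EGZ_good_inv_sum_free (prime_gt1 p_pr) _ => // A Afree.
  by apply: (leq_bigmax_cond (F := fun A : {set {ffun 'I_n -> F}} => #|A|)); apply/(Defs.decPP _).
exists l; split=> //; apply: (Rle_trans _ (K' * c ^ n)).
  apply: (Rle_trans _ _ _ (INR_leq l_le)); rewrite S_INR INR_muln /K'.
  have := pow_R1_Rle c n (Rlt_le _ _ c_gt1).
  have := Rmult_le_compat_l _ _ _ (pos_INR p.-1) M_le; lra.
rewrite Rmult_plus_distr_l Rmult_1_r Rpower_plus Rpower_pow; last lra.
rewrite Rmult_comm; apply: Rmult_le_compat_l; first by apply: pow_le; lra.
rewrite -[X in (X <= _)%R](exp_ln K') // /Rpower.
have Nn' := INR_leq Nn.
have : (ln K' <= INR n * eps * ln c)%R.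
  have := Rmult_lt_0_compat _ _ eps_gt0 lnc_gt0; nra.
by case=> [/exp_increasing|->]; [exact: Rlt_le | exact: Rle_refl].
Qed.
End RealBounds.

Theorem theorem4p3 (p : nat) (F : finFieldType) :
  prime p -> odd p ->
  (* q not a power of p: EGZ = infinity for every positive n *)
  ((~ exists k : nat, #|F| = expn p k) ->
     forall n : nat, (0 < n)%N -> EGZ p {ffun 'I_n -> F} p.-1 = None) /\
  (* q = p^k: EGZ(p, F_q^n, p-1) <= c^(n + o(n)) as n -> oo *)
  (forall k : nat, (0 < k)%N -> #|F| = expn p k ->
   forall c : R,
     ((p = 3 \/ p = 5) /\ k = 1 /\ c = INR #|F|
      \/ p = 3 /\ (2 <= k)%N /\ c = (2.756 ^ k + 1)%R
      \/ p <> 3 /\ (7 <= #|F|)%N /\ c = (2 ^ k * sqrt (INR #|F|) + 1)%R) ->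
   forall eps : R, (0 < eps)%R ->
   exists N : nat, forall n : nat, (N <= n)%N ->
     exists l : nat, EGZ p {ffun 'I_n -> F} p.-1 = Some l /\
                     (INR l <= Rpower c (INR n * (1 + eps)))%R).
Proof.
move=> p_pr p_odd; split=> [not_pow n n_gt0|k k_gt0 cardF c cE eps eps_gt0].
  exact: EGZ_None.
have p_gt1 := prime_gt1 p_pr.
have F_gt1 : (1 < INR #|F|)%R.
  by apply: (lt_INR 1); apply/ltP; rewrite cardF -[1]/(expn p 0) ltn_exp2l.
case: cE => [[_ [_ cE]]|[[p3 [_ cE]]|[p3 [_ cE]]]].
(* For [c] equal to the order of [F], the number of all vectors is the bound. *)
- apply: (EGZ_asymptotic (K := 1) p_pr cardF) => //; rewrite ?cE //; first lra.
  move=> n A _; rewrite Rmult_1_l -INR_expn; apply: INR_leq.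
  by rewrite -[X in expn _ X]card_ord -card_ffun max_card.
- subst p; apply: (EGZ_asymptotic (K := 3) p_pr cardF) => //; first lra.
    by rewrite cE; have : (0 < 2.756 ^ k)%R; [apply: pow_lt|]; lra.
  move=> n A; rewrite cE; apply: (card_inv_sum_free_INR p_pr cardF); try lra.
  exact: card_zero_sum_free_3_INR.
have p_ge4 : 4 <= p.
  by move: p_gt1 p_odd p3; case: p {p_pr cardF} => [|[|[|[|]]]].
have [K K_ge0 bound] := card_zero_sum_free_INR p_pr p_ge4.
have beta_ge0 : (0 <= 2 * sqrt (INR p))%R by have := sqrt_pos (INR p); lra.
(* Each coordinate in [F] counts for [k] coordinates over ['F_p], so the base is raised to the power
   [k]. *)
have betak : ((2 * sqrt (INR p)) ^ k = 2 ^ k * sqrt (INR #|F|))%R.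
  rewrite Rpow_mult_distr cardF INR_expn; congr (_ * _)%R.
  elim: (k) => [|j IHj] /=; first by rewrite sqrt_1.
  by rewrite IHj sqrt_mult //; [exact: pos_INR | apply/pow_le/pos_INR].
apply: (EGZ_asymptotic (K := K) p_pr cardF) => // [|n A].
  rewrite cE; have := sqrt_lt_1_alt 1 (INR #|F|); rewrite sqrt_1 => H.
  by have := pow_R1_Rle 2 k; nra.
by rewrite cE -betak; apply: (card_inv_sum_free_INR p_pr cardF).
Qed.
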